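(* Let $(X,d)$ be a pseudometric space, let $A$ be a complete subset of $X$, and let $\overline A$ be the closure of $A$ in $X$. Then $\overline A$ is also a complete subset of $X$, and $$\overline A=\bigcup_{a\in A}[a]_0,\qquad\text{where } [a]_0=\{x\in X:d(a,x)=0\}.$$
   Context: A pseudometric on $X$ is a nonnegative symmetric function $d:X^2\to\mathbb R$ with $d(x,x)=0$ satisfying the triangle inequality. $X$ carries the topology having the open balls $B_r(c)=\{x\in X:d(c,x)<r\}$, $r>0$, as a base. A sequence $(x_n)$ converges to $a$ if $d(x_n,a)\to 0$; Cauchy sequences are defined as in metric spaces. A subset $S\subseteq X$ is complete if every Cauchy sequence of points of $S$ converges to some point $a\in S$. *)

(* Defs.v *)
From HB Require Import structures.
From mathcomp Require Import all_boot all_order all_algebra.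
From mathcomp Require Import all_classical all_reals all_analysis.

Set Implicit Arguments.
Unset Strict Implicit.
Unset Printing Implicit Defensive.

Import Order.TTheory GRing.Theory Num.Theory.
Import numFieldNormedType.Exports.

Local Open Scope classical_set_scope.
Local Open Scope ring_scope.

(* The library's pseudoMetricType is axiomatized by its balls and carries no
   distance function, while its metricType assumes separation. *)
Record pseudometric (R : realType) (X : Type) := Pseudometric {
  pdist :> X -> X -> R ;
  pdist_ge0 : forall x y, 0 <= pdist x y ;
  pdistxx : forall x, pdist x x = 0 ;
  pdist_sym : forall x y, pdist x y = pdist y x ;
  pdist_triangle : forall x y z, pdist x z <= pdist x y + pdist y z
}.

Definition pball (R : realType) (X : Type) (d : pseudometric R X)
  (c : X) (r : R) : set X := [set x | d c x < r].

(* An alias of X whose canonical topology is the one induced by d; see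
   pspace_openP and pspace_closureP. *)
Definition pspace (R : realType) (X : Type) (d : pseudometric R X) : Type := X.

Section pspace_instances.
Context (R : realType) (X : Type) (d : pseudometric R X).

HB.instance Definition _ := gen_eqMixin (pspace d).
HB.instance Definition _ := gen_choiceMixin (pspace d).

Let ent : set_system (pspace d * pspace d) := entourage_ (pball d).

HB.instance Definition _ := hasNbhs.Build (pspace d) (nbhs_ ent).

Let pball_center (x : pspace d) (e : R) : 0 < e -> pball d x e x.
Proof. by rewrite /pball /= pdistxx. Qed.

Let pball_sym (x y : pspace d) (e : R) : pball d x e y -> pball d y e x.
Proof. by rewrite /pball /= pdist_sym. Qed.

Let pball_triangle (x y z : pspace d) (e1 e2 : R) :
  pball d x e1 y -> pball d y e2 z -> pball d x (e1 + e2) z.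
Proof.
move=> xy yz; apply: le_lt_trans (pdist_triangle d x y z) _.
exact: ltrD xy yz.
Qed.

HB.instance Definition _ := @Nbhs_isPseudoMetric.Build R (pspace d)
  ent erefl (pball d) pball_center pball_sym pball_triangle erefl.

End pspace_instances.

Section pspace_theory.
Context (R : realType) (X : Type) (d : pseudometric R X).

Lemma pspace_nbhsP (x : pspace d) (U : set (pspace d)) :
  nbhs x U <-> exists2 r, 0 < r & pball d x r `<=` U.
Proof. by rewrite -nbhs_ballE. Qed.

Lemma pball_open (c : pspace d) (r : R) : open (pball d c r : set (pspace d)).
Proof.
rewrite openE => x cx; apply/pspace_nbhsP; exists (r - d c x).
  by rewrite subr_gt0.
move=> y; rewrite /pball /= ltrBrDl => xy.
exact: le_lt_trans (pdist_triangle d c x y) xy.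
Qed.

Lemma pspace_openP (U : set (pspace d)) :
  open U <-> forall x, U x ->
    exists c r, [/\ 0 < r, pball d c r x & pball d c r `<=` U].
Proof.
split=> [|Ub].
  rewrite openE => oU x /oU /pspace_nbhsP[r r0 rU].
  by exists x, r; split=> //; rewrite /pball /= pdistxx.
rewrite openE => x /Ub [c [r [r0 cx cU]]].
by apply: filterS cU _; apply: open_nbhs_nbhs; split=> //; exact: pball_open.
Qed.

Lemma pspace_closureP (S : set (pspace d)) (x : pspace d) :
  closure S x <-> forall r : R, 0 < r -> exists2 y, S y & d x y < r.
Proof.
split=> [Sx r r0|Sx B /pspace_nbhsP[r r0 rB]].
  have [|y [Sy xy]] := Sx (pball d x r); first by apply/pspace_nbhsP; exists r.
  by exists y.
by have [y Sy xy] := Sx r r0; exists y; split=> //; exact: rB.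
Qed.

End pspace_theory.

Definition pcvg (R : realType) (X : Type) (d : pseudometric R X)
  (x : nat -> X) (a : X) : Prop := d (x n) a @[n --> \oo] --> (0 : R).

Definition pcauchy (R : realType) (X : Type) (d : pseudometric R X)
  (x : nat -> X) : Prop :=
  forall e : R, 0 < e ->
    exists N : nat, forall m n : nat, (N <= m)%N -> (N <= n)%N ->
      d (x m) (x n) < e.

Definition pcomplete (R : realType) (X : Type) (d : pseudometric R X)
  (S : set X) : Prop :=
  forall x : nat -> X, (forall n, S (x n)) -> pcauchy d x ->
    exists2 a, S a & pcvg d x a.

(* Main.v *)
(** A point x of the closure of A is the limit of a sequence of points of A; this
    sequence is Cauchy, so it also converges to some a in A, and two limits of
    the same sequence are at distance 0. Hence every point of the closure is at
    distance 0 from A, and a Cauchy sequence of the closure may be replaced,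
    without changing any distance, by a Cauchy sequence of A. *)

Require Import Defs.
From HB Require Import structures.
From mathcomp Require Import all_boot all_order all_algebra.
From mathcomp Require Import all_classical all_reals all_analysis.

Set Implicit Arguments.
Unset Strict Implicit.
Unset Printing Implicit Defensive.

Import Order.TTheory GRing.Theory Num.Theory.
Import numFieldNormedType.Exports.

Local Open Scope classical_set_scope.
Local Open Scope ring_scope.

Section pseudometric_sequences.
Context (R : realType) (X : Type) (d : pseudometric R X).
Implicit Types (x : nat -> X) (a b : X).

Lemma pcvgP x a :
  pcvg d x a <-> forall e, 0 < e ->
    exists N, forall n, (N <= n)%N -> d (x n) a < e.
Proof.
split=> [/cvgr0Pnorm_lt xa e e0|xa].
  have [N _ xN] := xa e e0; exists N => n Nn.
  by have := xN n Nn; rewrite /= ger0_norm ?pdist_ge0.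
apply/cvgr0Pnorm_lt => e e0; have [N xN] := xa e e0.
by exists N => // n Nn; rewrite /= ger0_norm ?pdist_ge0 //; exact: xN.
Qed.

Lemma pcvg_pcauchy x a : pcvg d x a -> pcauchy d x.
Proof.
move=> /pcvgP xa e e0; have [N xN] := xa _ (divr_gt0 e0 (ltr0n _ 2)).
exists N => m n Nm Nn; apply: le_lt_trans (pdist_triangle d _ a _) _.
by rewrite (pdist_sym d a) [e]splitr ltrD // xN.
Qed.

Lemma pcvg_dist0 x a b : pcvg d x a -> pcvg d x b -> d a b = 0.
Proof.
move=> /pcvgP xa /pcvgP xb; apply/eqP; rewrite eq_le pdist_ge0 andbT.
apply/ler_addgt0Pr => e e0; rewrite add0r.
have e2 := divr_gt0 e0 (ltr0n R 2).
have [N xN] := xa _ e2; have [M xM] := xb _ e2.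
(* The index [maxn N M] lies past both thresholds, so this one term is within [e / 2] of both
   limits. *)
apply: le_trans (pdist_triangle d _ (x (maxn N M)) _) _.
rewrite (pdist_sym d a) [e]splitr; apply/ltW/ltrD.
  by apply: xN; exact: leq_maxl.
by apply: xM; exact: leq_maxr.
Qed.

(** Each inequality is two triangle inequalities whose extra term is 0. This allows a sequence to be
    replaced termwise by one at distance 0. *)
Lemma pdist_congr a a' b b' : d a a' = 0 -> d b b' = 0 -> d a b = d a' b'.
Proof.
move=> aa' bb'; apply/eqP; rewrite eq_le; apply/andP; split.
  have := pdist_triangle d a a' b; rewrite aa' add0r => /le_trans; apply.
  have := pdist_triangle d a' b' b.
  by rewrite (pdist_sym d b') bb' addr0.
have := pdist_triangle d a' a b'; rewrite (pdist_sym d a' a) aa' add0r.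
move=> /le_trans; apply; have := pdist_triangle d a b b'.
by rewrite bb' addr0.
Qed.

Lemma closure_pcvg (S : set X) a : closure (S : set (pspace d)) a ->
  exists2 x, (forall n, S (x n)) & pcvg d x a.
Proof.
move=> /pspace_closureP Sa.
have /choice[x xP] : forall n, exists y, S y /\ d a y < n.+1%:R^-1.
  by move=> n; have [|y Sy ay] := Sa n.+1%:R^-1; [rewrite invr_gt0 | exists y].
exists x => [n|]; first by case: (xP n).
(* The radii [n.+1%:R^-1] of the chosen points are the terms of [harmonic], which tends to 0. *)
apply: (@squeeze_cvgr _ _ _ _ (cst 0) harmonic); last exact: cvg_harmonic.
- apply: nearW => n; rewrite pdist_ge0 /= pdist_sym.
  by apply: ltW; case: (xP n).
- exact: cvg_cst.
Qed.

Lemma pcomplete_closureE (A : set X) : pcomplete d A ->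
  closure (A : set (pspace d)) = \bigcup_(a in A) [set x | d a x = 0].
Proof.
move=> Ac; apply/seteqP; split=> [b /closure_pcvg[x Ax xb]|b [a Aa /= ab]].
  have [a Aa xa] := Ac x Ax (pcvg_pcauchy xb).
  by exists a => //; exact: pcvg_dist0 xa xb.
(* The same point [a] serves for every radius, since its distance to [b] is 0. *)
by apply/pspace_closureP => r r0; exists a; rewrite // pdist_sym ab.
Qed.

End pseudometric_sequences.

Theorem corollary2p9 (R : realType) (X : Type) (d : pseudometric R X)
  (A : set X) (hA : pcomplete d A) :
  pcomplete d (closure (A : set (pspace d))) /\
  closure (A : set (pspace d)) = \bigcup_(a in A) [set x | d a x = 0].
Proof.
split; last exact: pcomplete_closureE.
move=> x Ax xC; rewrite (pcomplete_closureE hA) in Ax.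
have /choice[a aP] : forall n, exists a, A a /\ d a (x n) = 0.
  by move=> n; have [a Aa ax] := Ax n; exists a.
(* Completeness of [A] is applied to the replacement sequence [a], which is Cauchy because its
   mutual distances are those of [x]. *)
have [n||b Ab ab] := hA a; first by case: (aP n).
  move=> e /xC[N xN]; exists N => m n Nm Nn.
  by rewrite (pdist_congr (aP m).2 (aP n).2) xN.
exists b; first exact: (@subset_closure (pspace d)).
(* The limit [b] of [a] is also a limit of [x], as both have the same distances to [b]. *)
have xaE n : d (x n) b = d (a n) b.
  by apply/esym/(pdist_congr (aP n).2); exact: pdistxx.
by rewrite /pcvg (eq_cvg _ _ xaE).
Qed.
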